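(* Let $k$ be a field and let $m\ge 2$ and $0\le d<m$ be integers. There exists a monomial ideal $I$ in $R=k[x,y,z,u,v]$ such that for all integers $t\ge 1$, $$\operatorname{depth} R/I^{(t)}=\begin{cases}2 & \text{if } t\equiv d \pmod m,\\ 1 & \text{otherwise}.\end{cases}$$
   Context: For a homogeneous ideal $I$ of $R$ and $t\ge 0$, the $t$-th symbolic power $I^{(t)}$ is the intersection of the primary components of $I^t$ associated with the minimal primes of $I$. *)

(* Defs.v *)
From mathcomp Require Import all_boot all_algebra.
From mathcomp Require Import mpoly.
Set Implicit Arguments. Unset Strict Implicit. Unset Printing Implicit Defensive.
Import GRing.Theory.
Local Open Scope ring_scope.

Section Ideals.
Variable R : comNzRingType.
Definition ideal_t := R -> Prop.

Definition is_ideal (I : ideal_t) : Prop :=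
  [/\ I 0, (forall a b, I a -> I b -> I (a + b)) & (forall r a, I a -> I (r * a))].

Definition subid (I J : ideal_t) : Prop := forall a, I a -> J a.

Definition gen_ideal (S : R -> Prop) : ideal_t :=
  fun f => forall J, is_ideal J -> subid S J -> J f.

Definition unit_ideal : ideal_t := fun _ => True.

Definition mul_ideal (I J : ideal_t) : ideal_t :=
  gen_ideal (fun f => exists a b, [/\ I a, J b & f = a * b]).

Fixpoint pow_ideal (I : ideal_t) (t : nat) : ideal_t :=
  match t with 0 => unit_ideal | t'.+1 => mul_ideal (pow_ideal I t') I end.

Definition add_ideal (I J : ideal_t) : ideal_t :=
  gen_ideal (fun f => I f \/ J f).

Definition is_prime (P : ideal_t) : Prop :=
  [/\ is_ideal P, ~ P 1 & forall a b, P (a * b) -> P a \/ P b].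

Definition minimal_prime (I P : ideal_t) : Prop :=
  [/\ is_prime P, subid I P &
      forall Q, is_prime Q -> subid I Q -> subid Q P -> subid P Q].

(* The primary component of J associated with a minimal prime P of J is
   uniquely determined: it is J R_P ∩ R = { f | exists s ∉ P, s f ∈ J }.
   The t-th symbolic power of I is the intersection of these components of
   I^t over the minimal primes P of I (the minimal primes of I^t are those
   of I). *)
Definition symb_pow (I : ideal_t) (t : nat) : ideal_t :=
  fun f => forall P, minimal_prime I P ->
    exists s, ~ P s /\ pow_ideal I t (s * f).

Definition seq_ideal (fs : seq R) : ideal_t := gen_ideal (fun f => f \in fs).

Definition regular_seq (M J : ideal_t) (fs : seq R) : Prop :=
  [/\ (forall f, f \in fs -> M f),
      (forall i g, (i < size fs)%N ->
          add_ideal J (seq_ideal (take i fs)) (nth 0 fs i * g) ->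
          add_ideal J (seq_ideal (take i fs)) g) &
      ~ add_ideal J (seq_ideal fs) 1].

Definition has_depth (M J : ideal_t) (n : nat) : Prop :=
  (exists fs, size fs = n /\ regular_seq M J fs) /\
  (forall fs, regular_seq M J fs -> (size fs <= n)%N).
End Ideals.

Definition monomial_ideal (k : fieldType) (I : ideal_t {mpoly k[5]}) : Prop :=
  exists S : 'X_{1..5} -> Prop,
    forall f, I f <-> gen_ideal (fun g => exists2 m, S m & g = 'X_[m]) f.

Definition max_ideal (k : fieldType) : ideal_t {mpoly k[5]} :=
  gen_ideal (fun g => exists i : 'I_5, g = 'X_i).

Definition depth_quot (k : fieldType) (J : ideal_t {mpoly k[5]}) (n : nat) :=
  has_depth (@max_ideal k) J n.

(* Main.v *)
Require Import Defs.
From mathcomp Require Import all_boot all_algebra.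
From mathcomp Require Import mpoly.
From mathcomp Require Import zify ring.
From Stdlib Require Import Classical.
Set Implicit Arguments. Unset Strict Implicit. Unset Printing Implicit Defensive.
Import GRing.Theory.

(** Take [I = Q1 ∩ Q2 ∩ Q3] with monomial primary components of incomparable
radicals [(x,y,z)], [(z,u,v)], [(x,z,v)], so that [I^(t) = Q1^t ∩ Q2^t ∩ Q3^t].
The first two components meet only at the origin and each meets the third one in
a line; hence [R/I^(t)] has depth 2 if every monomial of [Q3^t] lies in
[Q1^t ∪ Q2^t], and depth 1 otherwise.  Put [g = m - d].  The powers of [Q3] are
governed by [w = x^(2m-1) z v^3] and [w' = x^(2m-1-g) z^(1+g) v^2], which lie on
edges of the Newton polyhedra of [Q1] and [Q2].  The edge of [Q2^t] has a gap
exactly at [w^(t-1) w'], for every [t]; the edge of [Q1^t] consists of the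
[x^i z^j] with [i + j = 2mt] and [m | j].  As [w^(t-1) w'] has [z]-exponent
[t + g], it lies in [Q1^t ∪ Q2^t] exactly when [t = d] modulo [m], and all
other generators of [Q3^t] lie in [Q1^t ∪ Q2^t] at least for these [t]. *)

(** * Ideals and regular sequences *)

Section IdealTheory.
Local Open Scope ring_scope.
Variable R : comNzRingType.
Implicit Types (I J K : ideal_t R) (a b f g h r : R).

Lemma id0 I : is_ideal I -> I 0. Proof. by case. Qed.

Lemma idD I a b : is_ideal I -> I a -> I b -> I (a + b).
Proof. by case=> _ + _; apply. Qed.

Lemma idMl I r a : is_ideal I -> I a -> I (r * a).
Proof. by case=> _ _; apply. Qed.

Lemma idMr I r a : is_ideal I -> I a -> I (a * r).
Proof. by rewrite mulrC; apply: idMl. Qed.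

Lemma idN I a : is_ideal I -> I a -> I (- a).
Proof. by rewrite -mulN1r; apply: idMl. Qed.

Lemma idB I a b : is_ideal I -> I a -> I b -> I (a - b).
Proof. by move=> iI Ia Ib; apply: idD => //; apply: idN. Qed.

Lemma id_sum I (T : Type) (s : seq T) (P : pred T) (F : T -> R) : is_ideal I ->
  (forall i, P i -> I (F i)) -> I (\sum_(i <- s | P i) F i).
Proof.
move=> iI IF; elim/big_ind: _ => [|a b|//]; first exact: id0.
exact: idD.
Qed.

Lemma gen_ideal_ideal (S : R -> Prop) : is_ideal (gen_ideal S).
Proof.
split=> [J [J0 _ _] _ //|a b Ha Hb J iJ sJ|r a Ha J iJ sJ].
  by apply: idD => //; [apply: Ha|apply: Hb].
by apply: idMl => //; apply: Ha.
Qed.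

Lemma gen_idealS (S : R -> Prop) a : S a -> gen_ideal S a.
Proof. by move=> Sa J _; apply. Qed.

Lemma add_idealP I J f : is_ideal I -> is_ideal J ->
  add_ideal I J f <-> exists a b, [/\ I a, J b & f = a + b].
Proof.
move=> iI iJ; split; last first.
  case=> a [b [Ia Jb ->]]; apply: (idD (gen_ideal_ideal _)).
    by apply: gen_idealS; left.
  by apply: gen_idealS; right.
move/(_ (fun h => exists a b, [/\ I a, J b & h = a + b])); apply; last first.
  move=> a [Ia|Ja]; first by exists a, 0; rewrite addr0; split=> //; apply: id0.
  by exists 0, a; rewrite add0r; split=> //; apply: id0.
split=> [|_ _ [a [b [Ia Jb ->]]] [c [e [Ic Je ->]]]|r _ [a [b [Ia Jb ->]]]].
- by exists 0, 0; rewrite addr0; split=> //; apply: id0.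
- by exists (a + c), (b + e); rewrite addrACA; split=> //; apply: idD.
- by exists (r * a), (r * b); rewrite mulrDr; split=> //; apply: idMl.
Qed.

(** The ideal [I + (f)]; iterating it describes the quotients along a regular sequence. *)
Definition adjoin I f : ideal_t R := fun h => exists l, I (h - f * l).

Lemma adjoin_ideal I f : is_ideal I -> is_ideal (adjoin I f).
Proof.
move=> iI; split=> [|a b [l Il] [l' Il']|r a [l Il]].
- by exists 0; rewrite mulr0 subr0; apply: id0.
- by exists (l + l'); rewrite mulrDr opprD addrACA; apply: idD.
- by exists (r * l); rewrite mulrCA -mulrBr; apply: idMl.
Qed.

Lemma sub_adjoin I f a : I a -> adjoin I f a.
Proof. by exists 0; rewrite mulr0 subr0. Qed.

Lemma mem_adjoin I f r : is_ideal I -> adjoin I f (f * r).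
Proof. by exists r; rewrite subrr; apply: id0. Qed.

Lemma adjoin_sub I J f g : (forall h, I h -> J h) -> adjoin I f g -> adjoin J f g.
Proof. by move=> IJ [l Il]; exists l; apply: IJ. Qed.

Lemma seq_ideal_sub (s s' : seq R) f :
  {subset s <= s'} -> seq_ideal s f -> seq_ideal s' f.
Proof. by move=> ss' sf J iJ sJ; apply: sf => // h /ss'; apply: sJ. Qed.

Lemma add_ideal_rcons I s f h : is_ideal I ->
  add_ideal I (seq_ideal (rcons s f)) h <->
  adjoin (add_ideal I (seq_ideal s)) f h.
Proof.
move=> iI; have iS := gen_ideal_ideal (fun g => I g \/ seq_ideal s g).
split.
  have iA : is_ideal (adjoin (add_ideal I (seq_ideal s)) f) by apply: adjoin_ideal.
  move/(_ _ iA); apply=> g [Ig|]; first by apply: sub_adjoin; apply: gen_idealS; left.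
  move/(_ _ iA); apply=> e; rewrite mem_rcons inE => /orP[/eqP->|es].
    by rewrite -{2}[f]mulr1; apply: mem_adjoin.
  by apply: sub_adjoin; apply: gen_idealS; right; apply: gen_idealS.
have iS' := gen_ideal_ideal (fun g => I g \/ seq_ideal (rcons s f) g).
case=> l Hl; rewrite -[h](subrK (f * l)); apply: (idD iS').
  apply: Hl => // e [Ie|se]; apply: gen_idealS; [by left|right].
  by apply: seq_ideal_sub se => e' es; rewrite mem_rcons inE es orbT.
apply: (idMr _ iS'); apply: gen_idealS; right; apply: gen_idealS.
by rewrite mem_rcons inE eqxx.
Qed.

Lemma add_ideal_nil I h : is_ideal I -> add_ideal I (seq_ideal [::]) h <-> I h.
Proof.
move=> iI; split; last by move=> Ih; apply: gen_idealS; left.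
by move/(_ _ iI); apply=> e [//|]; move/(_ _ iI); apply.
Qed.

Definition nzdiv I f := forall h, I (f * h) -> I h.

(** This and the next two lemmas read off the first three entries; the tail stays arbitrary, so that
    every sequence that is too long can be refuted. *)
Lemma regular_seq1 (M J : ideal_t R) f fs : is_ideal J ->
  regular_seq M J (f :: fs) -> M f /\ nzdiv J f.
Proof.
move=> iJ [Mf rf _]; split; first by apply: Mf; rewrite mem_head.
by move=> h Jh; apply/add_ideal_nil => //; apply: (rf 0%N) => //; apply/add_ideal_nil.
Qed.

Lemma regular_seq2 (M J : ideal_t R) f g fs : is_ideal J ->
  regular_seq M J (f :: g :: fs) -> M g /\ nzdiv (adjoin J f) g.
Proof.
move=> iJ [Mf rf _]; split; first by apply: Mf; rewrite !inE eqxx orbT.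
have E a : adjoin J f a <-> add_ideal J (seq_ideal [:: f]) a.
  rewrite -[[:: f]]/(rcons [::] f); split.
    by move/(adjoin_sub (fun h => proj2 (add_ideal_nil h iJ)))/add_ideal_rcons; apply.
  by move/add_ideal_rcons => /(_ iJ); apply: adjoin_sub => h /add_ideal_nil; apply.
by move=> h /E Jh; apply/E; apply: (rf 1%N).
Qed.

Lemma regular_seq3 (M J : ideal_t R) f g e fs : is_ideal J ->
  regular_seq M J [:: f, g, e & fs] -> M e /\ nzdiv (adjoin (adjoin J f) g) e.
Proof.
move=> iJ [Mf rf _]; split; first by apply: Mf; rewrite !inE eqxx !orbT.
have E0 a : J a <-> add_ideal J (seq_ideal [::]) a by rewrite add_ideal_nil.
have E1 a : adjoin J f a <-> add_ideal J (seq_ideal [:: f]) a.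
  by rewrite -[[:: f]]/(rcons [::] f) add_ideal_rcons //; split; apply: adjoin_sub => h /E0.
have E2 a : adjoin (adjoin J f) g a <-> add_ideal J (seq_ideal [:: f; g]) a.
  rewrite -[[:: f; g]]/(rcons [:: f] g) add_ideal_rcons //.
  by split; apply: adjoin_sub => h /E1.
by move=> h /E2 Jh; apply/E2; apply: (rf 2%N).
Qed.

Lemma regular_seq_1 (M J : ideal_t R) f : is_ideal M -> is_ideal J ->
  (forall h, J h -> M h) -> ~ M 1 -> M f -> nzdiv J f -> regular_seq M J [:: f].
Proof.
move=> iM iJ JM M1 Mf rf; split.
- by move=> h; rewrite inE => /eqP->.
- case=> [|//] h _ /= Jh; apply/add_ideal_nil => //; apply: rf.
  by move/(add_ideal_nil _ iJ): Jh.
apply: contra_not M1; move/(_ _ iM); apply=> h [/JM //|]; move/(_ _ iM); apply=> e.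
by rewrite inE => /eqP->.
Qed.

Lemma regular_seq_2 (M J : ideal_t R) f g : is_ideal M -> is_ideal J ->
  (forall h, J h -> M h) -> ~ M 1 -> M f -> M g -> nzdiv J f ->
  nzdiv (adjoin J f) g -> regular_seq M J [:: f; g].
Proof.
move=> iM iJ JM M1 Mf Mg rf rg.
have E1 a : adjoin J f a <-> add_ideal J (seq_ideal [:: f]) a.
  rewrite -[[:: f]]/(rcons [::] f) add_ideal_rcons //.
  by split; apply: adjoin_sub => h /add_ideal_nil; apply.
split.
- by move=> h; rewrite !inE => /orP[]/eqP->.
- case=> [|[|//]] h _; first move=> /= Jh.
    by apply/add_ideal_nil => //; apply: rf; move/(add_ideal_nil _ iJ): Jh.
  by move/E1/rg/E1.
apply: contra_not M1; move/(_ _ iM); apply=> h [/JM //|]; move/(_ _ iM); apply=> e.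
by rewrite !inE => /orP[]/eqP->.
Qed.

Lemma add_ideal_ext I I' J f : (forall h, I h <-> I' h) ->
  add_ideal I J f -> add_ideal I' J f.
Proof.
move=> E If K iK sK; apply: If => // h [/E Ih|Jh]; apply: sK; [by left|by right].
Qed.

Lemma has_depth_ext (M J J' : ideal_t R) n :
  (forall h, J h <-> J' h) -> has_depth M J n -> has_depth M J' n.
Proof.
move=> E; have E' : forall h, J' h <-> J h by move=> h; rewrite E.
have tr (A B : ideal_t R) fs : (forall h, A h <-> B h) ->
    regular_seq M A fs -> regular_seq M B fs.
  move=> AB [Mf rf nf]; have BA h : B h <-> A h by rewrite AB.
  split=> // [i h lt_i Bh|Bf]; last by apply: nf; apply: add_ideal_ext Bf.
  by apply: (add_ideal_ext AB); apply: (rf i) => //; apply: add_ideal_ext Bh.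
case=> -[fs [sz rs]] ub; split.
  by exists fs; split=> //; apply: tr rs.
by move=> gs rg; apply: ub; apply: tr rg.
Qed.

(* [f]-divisibility can be glued along the exact sequence
   0 -> R/(A ∩ B) -> R/A ⊕ R/B -> R/(A + B) -> 0. *)
Lemma adjoin_glue (A B C : ideal_t R) f h : is_ideal A -> is_ideal B ->
  (forall r, A r -> C r) -> (forall r, B r -> C r) -> is_ideal C ->
  (forall r, C r -> exists a b, [/\ A a, B b & r = a + b]) -> nzdiv C f ->
  adjoin A f h -> adjoin B f h -> adjoin (fun r => A r /\ B r) f h.
Proof.
move=> iA iB AC BC iC CAB rf [l Al] [l' Bl'].
have /rf/CAB[a [b [Aa Bb E]]] : C (f * (l - l')).
  have -> : f * (l - l') = (h - f * l') - (h - f * l) by ring.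
  by apply: idB => //; [apply: BC|apply: AC].
exists (l - a); split.
  have -> : h - f * (l - a) = (h - f * l) + f * a by ring.
  by apply: idD => //; apply: idMl.
have -> : l - a = l' + b by rewrite -[b](addKr a) -E; ring.
have -> : h - f * (l' + b) = (h - f * l') - f * b by ring.
by apply: idB => //; apply: idMl.
Qed.

End IdealTheory.

(** * Monomial ideals *)

Section MonomialSets.
Variable n : nat.
Implicit Types (A B : {set 'I_n}) (V W : 'X_{1..n} -> Prop) (a b c : 'X_{1..n}).

Definition upset V := forall a b, (forall i, a i <= b i) -> V a -> V b.

(* [mono V] is primary for the ideal generated by the variables in [A]:
   [V] only sees the exponents in [A] and contains a power of each of them. *)
Definition primset A V :=
  (forall a b, (forall i, i \in A -> a i <= b i) -> V a -> V b) /\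
  exists N, forall a i, i \in A -> N <= a i -> V a.

(** Exponents of the [t]-th power of a monomial ideal; the power 0 is the unit ideal. *)
Fixpoint pow_mon V t a : Prop :=
  if t is t'.+1 then exists b c, [/\ pow_mon V t' b, V c & a = (b + c)%MM] else True.

Definition hits A a := [exists i in A, 0 < a i].

Lemma hitsPn A a : reflect (forall i, i \in A -> a i = 0) (~~ hits A a).
Proof.
rewrite negb_exists_in; apply: (iffP forall_inP) => H i /H; first by case: (a i).
by move->.
Qed.

Lemma primset_up A V : primset A V -> upset V.
Proof. by case=> H _ a b le_ab; apply: H => i _; apply: le_ab. Qed.

Lemma primset_pow A V t : primset A V -> primset A (pow_mon V t).
Proof.
case=> sat [N cof]; split.
  elim: t => [//|t IH] a a' le_aa' [b [c [Vb Vc Ea]]] /=.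
  (* Outside [A] the exponent [a'] need not dominate [b], so [b] is truncated to [A]; the rest of
     [a'] still dominates [c] on [A]. *)
  pose b' := [multinom (if i \in A then b i else 0) | i < n].
  have leb i : b' i <= a' i.
    rewrite mnmE; case: ifP => // /le_aa'; apply: leq_trans.
    by rewrite Ea mnmDE leq_addr.
  exists b', (a' - b')%MM; split; last 1 first.
  - by apply/mnmP=> i; rewrite mnmDE mnmBE subnKC.
  - by apply: IH Vb => i iA; rewrite mnmE iA.
  - apply: sat Vc => i iA; rewrite mnmBE mnmE iA leq_subRL.
      by have := le_aa' i iA; rewrite Ea mnmDE.
    by apply: leq_trans (le_aa' i iA); rewrite Ea mnmDE leq_addr.
exists (t * N); elim: t => [//|t IH] a i iA le_a.
exists (a - U_(i) *+ N)%MM, (U_(i) *+ N)%MM; split.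
- by apply: (IH _ i) => //; rewrite mnmBE mulmnE mnm1E eqxx; move: le_a; rewrite mulSn; lia.
- by apply: (cof _ i) => //; rewrite mulmnE mnm1E eqxx mul1n.
apply/mnmP=> j; rewrite mnmDE mnmBE mulmnE mnm1E subnK //.
by case: eqP => [<-|//]; move: le_a; rewrite mulSn; lia.
Qed.

Lemma primsetU A B V W : primset A V -> primset B W ->
  primset (A :|: B) (fun a => V a \/ W a).
Proof.
case=> satV [N cofV] [satW [N' cofW]]; split.
  move=> a b le_ab [Va|Wa]; [left; apply: satV Va|right; apply: satW Wa] => i iA;
    by apply: le_ab; rewrite inE iA ?orbT.
exists (maxn N N') => a i; rewrite inE geq_max => /orP[] iA /andP[leN leN'].
  by left; apply: cofV leN.
by right; apply: cofW leN'.
Qed.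

End MonomialSets.

Section MonomialIdeals.
Local Open Scope ring_scope.
Variables (n : nat) (k : fieldType).
Notation R := {mpoly k[n]}.
Implicit Types (A B : {set 'I_n}) (V W : 'X_{1..n} -> Prop) (a b c : 'X_{1..n}).
Implicit Types (f g h s : R).

(** An ideal when [V] is an upset, but also used for other [V], such as degree bounds. *)
Definition mono V : ideal_t R := fun f => forall a, a \in msupp f -> V a.

Lemma monoS V W f : (forall a, V a -> W a) -> mono V f -> mono W f.
Proof. by move=> VW Vf a /Vf/VW. Qed.

Lemma mono0 V : mono V 0.
Proof. by move=> a; rewrite msupp0. Qed.

Lemma monoD V f g : mono V f -> mono V g -> mono V (f + g).
Proof. by move=> Vf Vg a /msuppD_le; rewrite mem_cat => /orP[/Vf|/Vg]. Qed.

Lemma monoM V W X f g : (forall a b, V a -> W b -> X (a + b)%MM) ->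
  mono V f -> mono W g -> mono X (f * g).
Proof.
by move=> VWX Vf Wg a /msuppM_le /allpairsP[[b c] /= [/Vf Vb /Wg Wc ->]]; apply: VWX.
Qed.

Lemma monoX V a : mono V 'X_[a] <-> V a.
Proof.
split; first by apply; rewrite msuppX mem_head.
by move=> Va b; rewrite msuppX inE => /eqP->.
Qed.

Lemma mono_ideal V : upset V -> is_ideal (mono V).
Proof.
move=> upV; split; [exact: mono0|exact: monoD|move=> r f Vf].
apply: (monoM (V := fun=> True) _ _ Vf) => // a b _; apply: upV => i.
by rewrite mnmDE leq_addl.
Qed.

Lemma mono_sub V (K : ideal_t R) f : is_ideal K ->
  (forall a, V a -> K 'X_[a]) -> mono V f -> K f.
Proof.
move=> iK VK Vf; rewrite [f]mpolyE big_seq; apply: id_sum => // a /Vf/VK Ka.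
by rewrite -mul_mpolyC; apply: idMl.
Qed.

Lemma monoU V W f : upset V -> upset W -> mono (fun a => V a \/ W a) f ->
  exists g h, [/\ mono V g, mono W h & f = g + h].
Proof.
move=> /mono_ideal iV /mono_ideal iW Hf.
apply/(add_idealP _ iV iW); apply: mono_sub Hf; first exact: gen_ideal_ideal.
by move=> a [Va|Wa]; apply: gen_idealS; [left|right]; apply/monoX.
Qed.

(** The normal form of [f] modulo the variables in [A]. *)
Definition avoid A f : R := \sum_(a <- msupp f | ~~ hits A a) f@_a *: 'X_[a].

Lemma avoid_mono A f : mono (fun a => ~~ hits A a) (avoid A f).
Proof.
rewrite /avoid; elim/big_ind: _ => [|g h|a nA]; [exact: mono0|exact: monoD|].
by move=> b /msuppZ_le; rewrite msuppX inE => /eqP->.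
Qed.

Lemma avoidE A f : exists2 g, mono (hits A) g & f = avoid A f + g.
Proof.
exists (\sum_(a <- msupp f | hits A a) f@_a *: 'X_[a]).
  elim/big_ind: _ => [|g h|a nA]; [exact: mono0|exact: monoD|].
  by move=> b /msuppZ_le; rewrite msuppX inE => /eqP->.
by rewrite [LHS]mpolyE (bigID (hits A)) /= addrC.
Qed.

Lemma upset_hits A : upset (hits A).
Proof.
move=> a b le_ab /exists_inP[i iA ai]; apply/exists_inP; exists i => //.
exact: leq_trans (le_ab i).
Qed.

Lemma hits_ideal A : is_ideal (mono (hits A)).
Proof. exact/mono_ideal/upset_hits. Qed.

Lemma avoid_neq0 A f : ~ mono (hits A) f -> avoid A f != 0.
Proof.
by move=> nf; apply/eqP=> f0; apply: nf; have [g gA ->] := avoidE A f; rewrite f0 add0r.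
Qed.

Lemma mono_avoid A f : mono (fun a => ~~ hits A a) f -> mono (hits A) f -> f = 0.
Proof.
move=> Hf Hf'; apply/eqP; case: (eqVneq f 0) => // /mlead_supp fl.
by have := Hf _ fl; rewrite Hf'.
Qed.

(** The product of the [A]-free parts of [f] and [g] is [A]-free and lies in the ideal, so it is
    zero in a domain. *)
Lemma hits_prime A : is_prime (mono (hits A)).
Proof.
split; first exact: hits_ideal.
  move/(_ 0%MM); rewrite msupp1 inE eqxx => /(_ isT)/exists_inP[i _].
  by rewrite mnm0E.
move=> f g Hfg; apply: NNPP => /not_or_and[nf ng].
have nf0 := avoid_neq0 nf; have ng0 := avoid_neq0 ng.
have [f1 Hf1 Ef] := avoidE A f; have [g1 Hg1 Eg] := avoidE A g.
have iA := hits_ideal A.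
suff /eqP : avoid A f * avoid A g = 0 by rewrite mulf_eq0 (negPf nf0) (negPf ng0).
apply: (@mono_avoid A).
  apply: monoM (@avoid_mono A f) (@avoid_mono A g) => a b /hitsPn Ha /hitsPn Hb.
  by apply/hitsPn=> i iA'; rewrite mnmDE Ha ?Hb.
have -> : avoid A f * avoid A g = f * g - f1 * g - avoid A f * g1.
  by move: Ef Eg; set f0 := avoid A f; set g0 := avoid A g => -> ->; ring.
by apply: (idB iA (idB iA Hfg (idMr _ iA Hf1)) (idMl _ iA Hg1)).
Qed.

(** Monomials of [f ^+ t] have degree at least [t] in the variables of [A]; degree above [n * N]
    forces an exponent at least [N]. *)
Lemma mono_hits_pow A V f : primset A V -> mono (hits A) f ->
  exists L, mono V (f ^+ L).
Proof.
case=> _ [N cof] Hf; exists (n * N).+1.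
have H t : mono (fun a => t <= \sum_(i in A) a i)%N (f ^+ t).
  elim: t => [|t IH]; first by move=> a.
  rewrite exprSr; apply: monoM IH Hf => a b Ha /exists_inP[i iA bi].
  under eq_bigr do rewrite mnmDE.
  rewrite big_split /= -addn1 leq_add // (bigD1 i iA) /=.
  exact: leq_trans bi (leq_addr _ _).
apply: monoS (H _) => a; rewrite ltnNge => /negP nle.
have [/exists_inP[i iA /(cof _ _ iA)//]|] := boolP [exists i in A, N <= a i]%N.
rewrite negb_exists_in => /forall_inP ltN; case: nle.
have /leq_trans : (\sum_(i in A) a i <= \sum_(i in A) N)%N.
  by apply: leq_sum => i /ltN; rewrite -ltnNge => /ltnW.
apply; rewrite sum_nat_const leq_mul2r; apply/orP; right.
by have := max_card A; rewrite card_ord.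
Qed.

(** A power [s0] of the [A]-free part of [s] also multiplies [f] into [mono V], since the rest of
    [s] is nilpotent there. Then the leading terms of [f] are removed one by one. *)
Lemma nzdiv_mono A V s : primset A V -> ~ mono (hits A) s -> nzdiv (mono V) s.
Proof.
move=> pV nAs f Vsf; have iV := mono_ideal (primset_up pV).
have [s1 As1 Es] := avoidE A s; have [L Vs1] := mono_hits_pow pV As1.
pose s0 := avoid A s ^+ L.
have s0f : mono V (s0 * f).
  have -> : s0 = s * (\sum_(i < L) avoid A s ^+ (L.-1 - i) * (- s1) ^+ i) + (- s1) ^+ L.
    rewrite /s0; move: Es; set a := avoid A s => ->.
    by rewrite -{1}(opprK s1) -subrXX subrK.
  rewrite mulrDl mulrAC; apply: (idD iV); first exact: (idMr _ iV).
  by apply: (idMr _ iV); rewrite exprNn; apply: (idMl _ iV).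
have s0A : mono (fun a => ~~ hits A a) s0.
  rewrite /s0; elim: L {Vs1 s0 s0f} => [|L IH].
    by move=> a; rewrite msupp1 inE => /eqP->; apply/hitsPn=> i _; rewrite mnm0E.
  rewrite exprS; apply: monoM (@avoid_mono A s) IH => a b /hitsPn Ha /hitsPn Hb.
  by apply/hitsPn=> i iA; rewrite mnmDE Ha ?Hb.
have s00 : s0 != 0 by rewrite expf_neq0 // avoid_neq0.
have [N] := ubnP (size (msupp f)); elim: N f {Vsf} s0f => // N IH f s0f ltN.
have [->|f0] := eqVneq f 0; first exact: mono0.
have lf := mlead_supp f0; set l := mlead f in lf *.
(* Leading exponents add, and that of [s0] vanishes on [A], which is all that [V] sees. *)
have Vl : V l.
  apply: (pV.1 (mlead s0 + l)%MM); last first.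
    by apply: s0f; rewrite -mleadM // mlead_supp // mulf_neq0.
  move=> i iA; rewrite mnmDE.
  by move/hitsPn: (s0A _ (mlead_supp s00)) => /(_ i iA) ->.
have VX : mono V (f@_l *: 'X_[l]).
  by rewrite -mul_mpolyC; apply: (idMl _ iV); apply/monoX.
rewrite -(subrK (f@_l *: 'X_[l]) f); apply: monoD => //.
apply: IH; first by rewrite mulrBr; apply: (idB iV) => //; apply: (idMl _ iV).
rewrite (perm_size (msupp_rem _ _)) size_rem //.
by rewrite ltnS in ltN; apply: leq_trans ltN; rewrite prednK //; case: (msupp f) lf.
Qed.

End MonomialIdeals.

(** * Symbolic powers *)

Section SymbolicPowers.
Local Open Scope ring_scope.
Variables (n : nat) (k : fieldType) (T : finType).
Notation R := {mpoly k[n]}.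
Variables (A : T -> {set 'I_n}) (Q : T -> 'X_{1..n} -> Prop).
Hypothesis primQ : forall j, primset (A j) (Q j).
Hypothesis incomp : forall i j, A i \subset A j -> i = j.
Hypothesis properQ : forall j, ~ Q j 0%MM.
Implicit Types (a b c : 'X_{1..n}) (f g h s : R).

Definition meet (W : T -> 'X_{1..n} -> Prop) a := forall j, W j a.

Notation I := (mono (k := k) (meet Q)).

Lemma upset_meet : upset (meet Q).
Proof. by move=> a b le_ab Qa j; apply: primset_up (le_ab) (Qa j). Qed.

Lemma pow_ideal_ideal (J : ideal_t R) t : is_ideal (pow_ideal J t).
Proof. by case: t => [|t]; [split|apply: gen_ideal_ideal]. Qed.

Lemma pow_meet_sub j t f : pow_ideal I t f -> mono (pow_mon (Q j) t) f.
Proof.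
have iV u := mono_ideal k (primset_up (primset_pow u (primQ j))).
elim: t f => [|t IH] f; first by move=> _ a.
move/(_ _ (iV t.+1)); apply=> _ [a [b [/IH Ha Hb ->]]].
by apply: monoM Ha Hb => c c' Hc Hc'; exists c, c'; split.
Qed.

Lemma uniform_exponent : exists N, forall j a i, i \in A j -> (N <= a i)%N -> Q j a.
Proof.
have /fin_all_exists[N HN] j : exists N, forall a i, i \in A j -> (N <= a i)%N -> Q j a.
  by case: (primQ j).
exists (\max_j N j)%N => j a i iA le_a; apply: HN iA _.
exact: leq_trans (leq_bigmax j) le_a.
Qed.

(** Take high powers of all variables outside [A j]: by incomparability every other [A j'] contains
    such a variable. This monomial is the denominator for localizing at the prime of [A j]. *)
Lemma separating_exponent j : exists2 s, ~~ hits (A j) s &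
  forall c, Q j c -> meet Q (s + c)%MM.
Proof.
have [N HN] := uniform_exponent.
exists [multinom (if i \in A j then 0 else N)%N | i < n].
  by apply/hitsPn=> i iA; rewrite mnmE iA.
move=> c Qc j'; have [->|/eqP ne] := eqVneq j' j.
  by apply: primset_up (Qc) => // i; rewrite mnmDE leq_addl.
have /subsetPn[i iA' iA] : ~~ (A j' \subset A j) by apply/negP=> /incomp.
by apply: (HN _ _ i) => //; rewrite mnmDE mnmE (negPf iA) leq_addr.
Qed.

(** With [pow_meet_sub]: [I^t] and the [t]-th power of [Q j] agree after localization at the prime
    of [A j]. *)
Lemma pow_meet_sup j t : exists2 s, ~ mono (hits (A j)) s &
  forall f, mono (pow_mon (Q j) t) f -> pow_ideal I t (s * f).
Proof.
have [s /hitsPn s0 sQ] := separating_exponent j.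
exists 'X_[s *+ t].
  by move/monoX/exists_inP=> [i iA]; rewrite mulmnE s0.
move=> f; apply: (mono_sub (K := fun f => pow_ideal I t ('X_[s *+ t] * f))).
  have iP := pow_ideal_ideal I t; split=> [|a b Ha Hb|r a Ha].
  - by rewrite mulr0; apply: id0.
  - by rewrite mulrDr; apply: (idD iP).
  - by rewrite mulrCA; apply: (idMl _ iP).
elim: t {f} => [//|t IH] _ [b [c [/IH Hb /sQ Hc ->]]].
apply: gen_idealS; exists ('X_[s *+ t] * 'X_[b]), 'X_[s + c]; split=> //.
  exact/monoX.
rewrite -!mpolyXD; congr 'X_[_]; apply/mnmP=> i.
by rewrite !mnmDE !mulmnE; lia.
Qed.

(** The separating monomial moves [h] into [I], and [nzdiv_mono] cancels it again. *)
Lemma nzdiv_meet f j : nzdiv I f -> nzdiv (mono (Q j)) f.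
Proof.
move=> rf h Qfh; have [s s0 sQ] := separating_exponent j.
have iQ := mono_ideal k (primset_up (primQ j)).
have ns : ~ mono (hits (A j)) ('X_[s] : R) by move/monoX; apply/negP.
apply: (nzdiv_mono (primQ j) ns).
suff : I ('X_[s] * h) by apply: monoS => a; apply.
apply: rf; rewrite mulrCA; apply: (monoM (V := fun a => a = s) _ _ Qfh).
  by move=> a b -> /sQ.
by apply/monoX.
Qed.

Lemma mono_hits_sub (B : {set 'I_n}) (P : ideal_t R) f : is_ideal P ->
  (forall i, i \in B -> P 'X_i) -> mono (hits B) f -> P f.
Proof.
move=> iP HP; apply: mono_sub => // a /exists_inP[i iB ai].
have -> : a = (U_(i) + (a - U_(i)))%MM.
  apply/mnmP=> l; rewrite mnmDE mnmBE mnm1E; case: eqP => [<-|_] /=; last by rewrite add0n subn0.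
  by rewrite subnKC.
by rewrite mpolyXD; apply: idMr => //; apply: HP.
Qed.

(** Otherwise each [A j] has a variable outside [P], and the product of high powers of these
    variables lies in [I], hence in [P]. *)
Lemma prime_over P : is_prime P -> (forall f, I f -> P f) ->
  exists j, forall f, mono (hits (A j)) f -> P f.
Proof.
case=> iP P1 PM IP; apply: NNPP => nP.
have /fin_all_exists[l Hl] j : exists i, i \in A j /\ ~ P 'X_i.
  apply: NNPP => nl; apply: nP; exists j => f; apply: mono_hits_sub => // i iA.
  by apply: NNPP => nPi; apply: nl; exists i.
have [N HN] := uniform_exponent.
have Pprod (r : seq T) (F : T -> R) : P (\prod_(j <- r) F j) -> exists j, P (F j).
  elim: r => [|j r IH]; first by rewrite big_nil.
  by rewrite big_cons => /PM[Pj|/IH//]; exists j.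
have Ppow f e : P (f ^+ e) -> P f.
  by elim: e => [//|e IH]; rewrite exprS => /PM[|/IH].
have [|j] := @Pprod (index_enum T) (fun j => 'X_(l j) ^+ N).
  under eq_bigr do rewrite mpolyXn.
  rewrite -(big_morph _ (@mpolyXD n k) (mpolyX0 n k)); apply: IP; apply/monoX => j; apply: (HN _ _ (l j)).
    by case: (Hl j).
  by rewrite mnm_sumE (bigD1 j) //= mulmnE mnm1E eqxx mul1n leq_addr.
by move/Ppow; case: (Hl j).
Qed.

Lemma meet_hits j f : I f -> mono (hits (A j)) f.
Proof.
apply: monoS => a /(_ j) Qa; apply: contra_notT (properQ (j := j)) => /hitsPn a0.
by apply: (primQ j).1 Qa => i /a0->.
Qed.

Lemma hits_inj i j : (forall f, mono (hits (A i)) f -> mono (hits (A j)) f) -> i = j.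
Proof.
move=> H; apply: incomp; apply/subsetP=> l iA.
have /H/monoX/exists_inP[l' jA] : mono (k := k) (hits (A i)) 'X_[U_(l)].
  by apply/monoX/exists_inP; exists l => //; rewrite mnm1E eqxx.
by rewrite mnm1E; case: eqP => [->|].
Qed.

Lemma minimal_prime_meet P : minimal_prime I P ->
  exists j, forall f, P f <-> mono (hits (A j)) f.
Proof.
case=> pP IP minP; have [j jP] := prime_over pP IP.
exists j => f; split; last exact: jP.
by apply: minP => // [|g]; [exact: hits_prime|exact: meet_hits].
Qed.

Lemma minimal_prime_hits j : minimal_prime I (mono (hits (A j))).
Proof.
split; [exact: hits_prime|by move=> f; apply: meet_hits|].
move=> P pP IP Pj; have [i iP] := prime_over pP IP.
suff <- : i = j by [].
by apply: hits_inj => f /iP/Pj.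
Qed.

(** The minimal primes of [I] are those of the [A j]; localizing [I^t] at one of them leaves the
    power of [Q j], which is primary. *)
Lemma symb_pow_meet t f :
  symb_pow I t f <-> mono (meet (fun j => pow_mon (Q j) t)) f.
Proof.
split=> [H a fa j|Hf P /minimal_prime_meet[j jP]].
  have [s [ns /(pow_meet_sub j) Hs]] := H _ (minimal_prime_hits j).
  exact: (nzdiv_mono (primset_pow t (primQ j)) ns Hs).
have [s ns Hs] := pow_meet_sup j t; exists s; split; first by move/jP.
by apply: Hs; apply: monoS Hf => a; apply.
Qed.

Lemma meet_monomial f : I f <-> gen_ideal (fun g => exists2 a, meet Q a & g = 'X_[a]) f.
Proof.
split; first by apply: mono_sub => [|a Qa]; [exact: gen_ideal_ideal|apply: gen_idealS; exists a].
move/(_ _ (mono_ideal k upset_meet)); apply=> _ [a Qa ->]; exact/monoX.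
Qed.

End SymbolicPowers.

(** * Depth *)

Lemma bounded_maximal n (S : 'X_{1..n} -> Prop) D a :
  (forall b, S b -> mdeg b <= D) -> S a ->
  exists2 b, S b & forall i, ~ S (b + U_(i))%MM.
Proof.
move=> bS; have [e] := ubnP (D - mdeg a); elim: e a => // e IH a lt_e Sa.
have [[i Si]|nS] := classic (exists i, S (a + U_(i))%MM); last first.
  by exists a => // i Si; apply: nS; exists i.
apply: (IH _ _ Si); have := bS _ Si; rewrite mdegD mdeg1 addn1; lia.
Qed.

(** * Depth at most one: a socle element *)

Section DepthAtMostOne.
Local Open Scope ring_scope.
Variables (n : nat) (k : fieldType) (T : finType).
Notation R := {mpoly k[n]}.
Variables (A : T -> {set 'I_n}) (Q : T -> 'X_{1..n} -> Prop).
Hypothesis primQ : forall j, primset (A j) (Q j).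
Hypothesis incomp : forall i j, A i \subset A j -> i = j.
Notation I := (mono (k := k) (meet Q)).
Notation M := (mono (k := k) (hits [set: 'I_n])).

(* The two components [i1], [i2] meet only at the origin and nothing else
   connects them in degree [a]: the class of the element [p] below is a nonzero
   socle element of R/(I + f). *)
Lemma not_regular2 i1 i2 a (f g : R) : A i1 :|: A i2 = setT ->
  ~ Q i1 a -> ~ Q i2 a -> (forall j, j != i1 -> j != i2 -> Q j a) ->
  M f -> M g -> nzdiv I f -> ~ nzdiv (adjoin I f) g.
Proof.
move=> A12 n1 n2 Qa Mf Mg rf rg.
pose W b := forall j, j != i1 -> j != i2 -> Q j b.
have upQ j := primset_up (primQ j).
have upW : upset W by move=> b c le_bc Wb j j1 j2; apply: (upQ j _ _ le_bc); apply: Wb.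
have [N HN] := uniform_exponent primQ.
pose S b := [/\ ~ Q i1 b, ~ Q i2 b & W b].
(* Exponents outside both components are bounded by [N], because [A i1] and [A i2] cover all
   variables. *)
have {Qa n1 n2 a}[a [n1 n2 Wa] maxa] : exists2 b, S b & forall i, ~ S (b + U_(i))%MM.
  apply: (@bounded_maximal n S (n * N) a); last by split.
  move=> b [n1' n2' _]; rewrite mdegE.
  have /leq_trans : (\sum_(i < n) b i <= \sum_(i < n) N)%N.
    apply: leq_sum => i _; rewrite leqNgt; apply/negP=> /ltnW Nb.
    have : i \in A i1 :|: A i2 by rewrite A12 inE.
    by rewrite inE => /orP[] iA; [apply: n1'|apply: n2']; apply: HN iA Nb.
  by apply; rewrite sum_nat_const card_ord.
pose V1 b := Q i1 b /\ W b; pose V2 b := Q i2 b /\ W b.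
have step i : V1 (a + U_(i))%MM \/ V2 (a + U_(i))%MM.
  have Wi : W (a + U_(i))%MM by apply: upW Wa => l; rewrite mnmDE leq_addr.
  apply: NNPP => /not_or_and[h1 h2]; apply: (maxa i).
  by split=> // Qi; [apply: h1|apply: h2].
have up1 : upset V1 by move=> b c le_bc [Qb Wb]; split; [apply: upQ Qb|apply: upW Wb].
have up2 : upset V2 by move=> b c le_bc [Qb Wb]; split; [apply: upQ Qb|apply: upW Wb].
have V12 b : V1 b -> Q i2 b -> meet Q b.
  move=> [Q1 Wb] Q2 j; have [->//|j1] := eqVneq j i1; have [->//|j2] := eqVneq j i2.
  exact: Wb.
have V21 b : V2 b -> Q i1 b -> meet Q b.
  move=> [Q1 Wb] Q2 j; have [->//|j1] := eqVneq j i1; have [->//|j2] := eqVneq j i2.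
  exact: Wb.
have iI := mono_ideal k (upset_meet primQ).
have iV1 := mono_ideal k up1; have iV2 := mono_ideal k up2.
have iQ j := mono_ideal k (upQ j).
(* Each monomial of [f * 'X_[a]] is divisible by some ['X_[a + U_(i)]], so it lies in [V1] or [V2]
   by maximality of [a]. *)
have [p [q [Vp Vq E]]] : exists p q, [/\ mono V1 p, mono V2 q & f * 'X_[a] = p + q].
  apply: monoU => //; apply: (monoM (W := fun b => b = a) _ Mf); last exact/monoX.
  move=> b _ /exists_inP[i _ bi] ->.
  have le_b l : ((a + U_(i))%MM l <= (b + a)%MM l)%N.
    rewrite !mnmDE mnm1E addnC leq_add2r; case: eqP => [<-|]//=.
  by have [H|H] := step i; [left; apply: up1 H|right; apply: up2 H].
(* Each variable multiplies [p] into [I + (f)], hence so does [g], which can be cancelled. *)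
have pI : adjoin I f p.
  apply: rg; have iK := adjoin_ideal f iI.
  apply: (mono_hits_sub (B := setT) (P := fun g => adjoin I f (g * p))) Mg.
    split=> [|b c Hb Hc|r b Hb]; first by rewrite mul0r; apply: id0.
    - by rewrite mulrDl; apply: (idD iK).
    - by rewrite -mulrA; apply: (idMl _ iK).
  move=> i _; have Ei : 'X_i * p = f * 'X_[a + U_(i)] - 'X_i * q.
    by rewrite mpolyXD mulrA E; ring.
  have [/monoX H|/monoX H] := step i.
    exists 'X_[a + U_(i)]; rewrite Ei addrAC subrr add0r.
    apply: (idN iI) => b Hb; apply: V21; first exact: (idMl _ iV2 Vq) Hb.
    have : mono V1 ('X_i * q).
      have -> : 'X_i * q = f * 'X_[a + U_(i)] - 'X_i * p by rewrite Ei; ring.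
      apply: (idB iV1); first exact: (idMl _ iV1 (H k)).
      exact: (idMl _ iV1).
    by move/(_ _ Hb) => [].
  apply: sub_adjoin => b Hb; apply: V12; first exact: (idMl _ iV1 Vp) Hb.
  have : mono V2 ('X_i * p).
    rewrite Ei; apply: (idB iV2); first exact: (idMl _ iV2 (H k)).
    exact: (idMl _ iV2).
  by move/(_ _ Hb) => [].
(* Cancelling [f] puts [l] in the first component and ['X_[a] - l] in the second, so [a] lies in one
   of them. *)
have [l Hl] := pI.
have Ql : mono (Q i1) l.
  apply: (nzdiv_meet primQ incomp rf).
  have -> : f * l = p - (p - f * l) by ring.
  apply: (idB (iQ i1)); first by apply: monoS Vp => b [].
  by apply: monoS Hl => b; apply.
have Ql' : mono (Q i2) ('X_[a] - l).
  apply: (nzdiv_meet primQ incomp rf).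
  have -> : f * ('X_[a] - l) = q + (p - f * l) by rewrite mulrBr E; ring.
  apply: (idD (iQ i2)); first by apply: monoS Vq => b [].
  by apply: monoS Hl => b; apply.
have : mono (k := k) (fun b => Q i1 b \/ Q i2 b) 'X_[a].
  rewrite -(subrK l 'X_[a]); apply: monoD.
    by apply: monoS Ql' => b; right.
  by apply: monoS Ql => b; left.
by case/monoX.
Qed.

End DepthAtMostOne.

(** * Depth at most two: algebraic independence *)

Section DepthAtMostTwo.
Local Open Scope ring_scope.

Lemma linear_relation (k : fieldType) (S T : finType) (M : T -> S -> k) :
  (#|S| < #|T|)%N ->
  exists2 c : T -> k, exists t, c t != 0 & forall s, \sum_t c t * M t s = 0.
Proof.
move=> ltST; pose X := \matrix_(i < #|T|, j < #|S|) M (enum_val i) (enum_val j).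
have : kermx X != 0.
  by rewrite kermx_eq0; apply/negP=> /eqP rX; have := rank_leq_col X; rewrite rX leqNgt ltST.
rewrite -nz_row_eq0; set v := nz_row _ => v0.
have vX : v *m X = 0 by apply/eqP; rewrite -sub_kermx nz_row_sub.
exists (fun t => v 0 (enum_rank t)).
  have /rV0Pn[i vi] := v0; by exists (enum_val i); rewrite enum_valK.
move=> s; have /rowP/(_ (enum_rank s)) := vX; rewrite !mxE => E; rewrite -[RHS]E.
rewrite (reindex (@enum_val T predT)) /=; last exact/onW_bij/enum_val_bij.
by apply: eq_bigr => i _; rewrite !mxE !enum_rankK enum_valK.
Qed.

Variables (n : nat) (k : fieldType).
Notation R := {mpoly k[n]}.

(** Evaluation in one, two and three variables. Iterated univariate polynomials allow peeling off
    one variable at a time; the outermost goes to the first argument. *)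
Definition ev1 (f : R) : {rmorphism {poly k} -> R} :=
  horner_eval f \o map_poly (mpolyC n (R := k)).
Definition ev2 (f g : R) : {rmorphism {poly {poly k}} -> R} :=
  horner_eval f \o map_poly (ev1 g).
Definition ev3 (f g h : R) : {rmorphism {poly {poly {poly k}}} -> R} :=
  horner_eval f \o map_poly (ev2 g h).

Lemma ev_poly (S : nzRingType) (phi : {rmorphism S -> R}) f N (E : nat -> S) :
  (horner_eval f \o map_poly phi) (\poly_(i < N) E i) = \sum_(i < N) phi (E i) * f ^+ i.
Proof.
rewrite /= /horner_eval poly_def rmorph_sum horner_sum; apply: eq_bigr => i _.
by rewrite /= -mul_polyC rmorphM /= map_polyC map_polyXn hornerCM hornerXn.
Qed.

(** A nonzero constant coefficient [c] would put [phi c] in [K + (f)]; if it is zero, a factor [f]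
    cancels. *)
Lemma nzdiv_ev (S : nzRingType) (phi : {rmorphism S -> R}) (K : ideal_t R) f :
  is_ideal K -> nzdiv K f -> (forall c, c != 0 -> ~ adjoin K f (phi c)) ->
  forall F : {poly S}, F != 0 -> ~ K ((horner_eval f \o map_poly phi) F).
Proof.
move=> iK rf nphi; elim/poly_ind => [|F c IH]; first by rewrite eqxx.
rewrite /= /horner_eval rmorphD rmorphM /= map_polyX map_polyC hornerMXaddC mulrC.
have [->|c0 _ HK] := eqVneq c 0; last first.
  apply: (nphi c c0); exists (- (map_poly phi F).[f]).
  by rewrite mulrN opprK addrC.
rewrite addr0 raddf0 addr0 => H /rf; apply: IH.
by apply: contraNneq H => ->; rewrite mul0r.
Qed.

(** Three uses of [nzdiv_ev] end with a nonzero constant in [J + (f1, f2, f3)], hence in [P]. So a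
    regular sequence in [P] is algebraically independent over [k] modulo [J]. *)
Lemma ev3_neq0 (J P : ideal_t R) f1 f2 f3 : is_ideal J -> is_prime P ->
  (forall h, J h -> P h) -> P f1 -> P f2 -> P f3 ->
  nzdiv J f1 -> nzdiv (adjoin J f1) f2 -> nzdiv (adjoin (adjoin J f1) f2) f3 ->
  forall F, F != 0 -> ~ J (ev3 f1 f2 f3 F).
Proof.
move=> iJ [iP P1 _] JP Pf1 Pf2 Pf3 r1 r2 r3.
have adP (K : ideal_t R) f : (forall h, K h -> P h) -> P f -> forall h, adjoin K f h -> P h.
  move=> KP Pf h [l /KP Pl]; rewrite -(subrK (f * l) h); apply: idD => //.
  exact: idMr.
apply: nzdiv_ev => // F3 F30; apply: nzdiv_ev F30 => //; first exact: adjoin_ideal.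
move=> F2 F20; apply: nzdiv_ev F20 => // [|c c0 Hc]; first by do 2 apply: adjoin_ideal.
apply: P1; have Pc : P c%:MP by apply: (adP _ f3 _ _ _ Hc) => // h; apply: (adP) => // h'; apply: (adP).
have -> : 1 = c^-1%:MP * c%:MP :> R by rewrite -mpolyCM mulVf // mpolyC1.
exact: idMl.
Qed.

Lemma mdeg_msize (f : R) : mono (fun a => mdeg a <= msize f)%N f.
Proof. by move=> a /msize_mdeg_lt/ltnW. Qed.

Lemma mono_degM D E (f g : R) : mono (fun a => mdeg a <= D)%N f ->
  mono (fun a => mdeg a <= E)%N g -> mono (fun a => mdeg a <= D + E)%N (f * g).
Proof. by apply: monoM => a b Ha Hb; rewrite mdegD leq_add. Qed.

Lemma mono_degX D e (f : R) : mono (fun a => mdeg a <= D)%N f ->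
  mono (fun a => mdeg a <= e * D)%N (f ^+ e).
Proof.
move=> Hf; elim: e => [|e IH]; first by move=> a; rewrite msupp1 inE => /eqP->; rewrite mdeg0.
by rewrite exprS mulSn; apply: mono_degM.
Qed.

(* Counting: the [N^3] products of powers below degree [N] have fewer than
   [N^3] coefficients at monomials in the variables [p j], [q j]. *)
Lemma algebraic_relation (T : finType) (A : T -> {set 'I_n}) (p q : T -> 'I_n) (f1 f2 f3 : R) :
  (forall j i, [|| i \in A j, i == p j | i == q j]) ->
  exists2 F, F != 0 & forall j, mono (hits (A j)) (ev3 f1 f2 f3 F).
Proof.
move=> Apq; pose D := (msize f1 + msize f2 + msize f3)%N.
(* Each product has degree below [K <= N * (D + 1)], so at most
   [#|T| * (N * (D + 1)) ^ 2 = N.-1 * N ^ 2] equations face [N ^ 3] unknowns. *)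
pose N := (#|T| * (D + 1) ^ 2).+1; pose K := (N.-1 * D).+1.
pose term (e : 'I_N * 'I_N * 'I_N) : R := f1 ^+ e.1.1 * f2 ^+ e.1.2 * f3 ^+ e.2.
have degterm e : mono (fun a => mdeg a < K)%N (term e).
  have [e1 e2 e3] : [/\ e.1.1 <= N.-1, e.1.2 <= N.-1 & e.2 <= N.-1]%N.
    by split; rewrite -ltnS.
  have := mono_degM (mono_degM (mono_degX (e := e.1.1) (mdeg_msize (f := f1)))
    (mono_degX (e := e.1.2) (mdeg_msize (f := f2)))) (mono_degX (e := e.2) (mdeg_msize (f := f3))).
  apply: monoS => a /leq_trans; apply.
  by rewrite /D !mulnDr !leq_add // leq_mul2r ?e1 ?e2 ?e3 orbT.
pose mon (s : T * 'I_K * 'I_K) : 'X_{1..n} :=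
  [multinom (if i == p s.1.1 then s.1.2 : nat else if i == q s.1.1 then s.2 : nat else 0)%N | i < n].
have [|c [t ct] Hc] := @linear_relation k (T * 'I_K * 'I_K)%type ('I_N * 'I_N * 'I_N)%type
    (fun e s => (term e)@_(mon s)).
  rewrite !card_prod !card_ord.
  have leK : (K <= N * (D + 1))%N by rewrite /K -[N]/(N.-1.+1) mulnDr muln1 mulSn; lia.
  apply: (@leq_ltn_trans (#|T| * (N * (D + 1)) * (N * (D + 1)))%N).
    by apply: leq_mul => //; apply: leq_mul.
  have -> : (#|T| * (N * (D + 1)) * (N * (D + 1)) = N.-1 * (N * N))%N by rewrite /N /=; ring.
  by rewrite -[X in (_ < X)%N]mulnA ltn_mul2r muln_gt0 !ltn0Sn /N ltnSn.
pose c' i j l := c (inord i, inord j, inord l) : k.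
exists (\poly_(i < N) \poly_(j < N) \poly_(l < N) c' i j l).
  apply: contraNneq ct => /(congr1 (fun P : {poly {poly {poly k}}} => P`_t.1.1`_t.1.2`_t.2)).
  rewrite !(coef_poly, ltn_ord) !coef0 /c' !inord_val => <-.
  by case: t => [[a b] d] /=.
move=> j a; apply: contraTT => /hitsPn Ha; rewrite mcoeff_msupp negbK.
have -> : ev3 f1 f2 f3 (\poly_(i < N) \poly_(j < N) \poly_(l < N) c' i j l)
    = \sum_e c e *: term e.
  transitivity (\sum_(i < N) \sum_(j < N) \sum_(l < N) c (i, j, l) *: term (i, j, l)).
    rewrite [LHS](ev_poly (ev2 f2 f3)); apply: eq_bigr => e1 _.
    rewrite [ev2 _ _ _](ev_poly (ev1 f3)) mulr_suml; apply: eq_bigr => e2 _.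
    rewrite [ev1 _ _](ev_poly (mpolyC n (R := k))) !mulr_suml; apply: eq_bigr => e3 _.
    by rewrite /c' !inord_val -mul_mpolyC /term /=; ring.
  by rewrite pair_big pair_big; apply: eq_bigr => -[[e1 e2] e3] _.
rewrite raddf_sum /=; have [ltK|leK] := ltnP (mdeg a) K; last first.
  rewrite big1 // => e _; rewrite mcoeffZ; apply/eqP; rewrite mulf_eq0; apply/orP; right.
  by rewrite mcoeff_eq0; apply/negP=> /degterm; rewrite ltnNge leK.
have ltK' i : (a i < K)%N.
  by apply: leq_ltn_trans ltK; rewrite mdegE (bigD1 i) //= leq_addr.
have -> : a = mon (j, Ordinal (ltK' (p j)), Ordinal (ltK' (q j))).
  apply/mnmP=> i; rewrite mnmE /=; case: eqP => [->//|/eqP ip]; case: eqP => [->//|/eqP iq].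
  by have := Apq j i; rewrite (negPf ip) (negPf iq) !orbF => /Ha.
by under eq_bigr do rewrite mcoeffZ; rewrite Hc.
Qed.

(** Each component has dimension at most two, so some nonzero [F] evaluates into all radicals; a
    power of it evaluates into the ideal, against [ev3_neq0]. *)
Lemma not_regular3 (T : finType) (A : T -> {set 'I_n}) (Q : T -> 'X_{1..n} -> Prop)
    (p q : T -> 'I_n) (P : ideal_t R) f1 f2 f3 :
  (forall j, primset (A j) (Q j)) -> (forall j i, [|| i \in A j, i == p j | i == q j]) ->
  is_prime P -> (forall h, mono (meet Q) h -> P h) -> P f1 -> P f2 -> P f3 ->
  nzdiv (mono (meet Q)) f1 -> nzdiv (adjoin (mono (meet Q)) f1) f2 ->
  ~ nzdiv (adjoin (adjoin (mono (meet Q)) f1) f2) f3.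
Proof.
move=> primQ Apq pP IP Pf1 Pf2 Pf3 r1 r2 r3.
have [F F0 HF] := algebraic_relation f1 f2 f3 Apq.
have /fin_all_exists[L HL] j := mono_hits_pow (primQ j) (HF j).
have iQ j := mono_ideal k (primset_up (primQ j)).
have iI := mono_ideal k (upset_meet primQ).
apply: (ev3_neq0 iI pP IP Pf1 Pf2 Pf3 r1 r2 r3 (expf_neq0 (\max_j L j)%N F0)).
move=> a Ha j; move: a Ha; rewrite rmorphXn.
have : (L j <= \max_j L j)%N by apply: leq_bigmax.
by move/subnK => <-; rewrite exprD; apply: (idMl _ (iQ j)).
Qed.

End DepthAtMostTwo.

(** * Depth at least two: gluing components *)

Section DepthAtLeastTwo.
Local Open Scope ring_scope.
Variables (n : nat) (k : fieldType).
Notation R := {mpoly k[n]}.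
Implicit Types (A : {set 'I_n}) (V : 'X_{1..n} -> Prop) (f g h : R) (p q i : 'I_n).

(** Reduction modulo ['X_p + 'X_q], as a substitution. *)
Definition elim_var p q : n.-tuple R := [tuple (if i == p then - 'X_q else 'X_i) | i < n].

Lemma elim_varE p q i : 'X_i \mPo elim_var p q = if i == p then - 'X_q else 'X_i.
Proof. by rewrite comp_mpolyXU -tnth_nth tnth_mktuple. Qed.

Lemma elim_var_mod p q h : exists l, h - (h \mPo elim_var p q) = ('X_p + 'X_q) * l.
Proof.
pose D h := exists l, h - (h \mPo elim_var p q) = ('X_p + 'X_q) * l.
have DM g h' : D g -> D h' -> D (g * h').
  move=> [l El] [l' El']; exists (l * h' + (g \mPo elim_var p q) * l').
  by rewrite rmorphM mulrDr mulrA -El mulrCA -El'; ring.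
have D0 c : D c%:MP by exists 0; rewrite comp_mpolyC subrr mulr0.
elim/mpolyind: h => [|c a h _ _ [l' El']]; first by rewrite -mpolyC0; apply: D0.
have [l El] : D (c%:MP * 'X_[a]).
  apply: (DM) => //; rewrite mpolyXE_id; elim/big_ind: _ => [|//|i _].
    by rewrite -mpolyC1.
  elim: (a i) => [|e IH]; first by rewrite expr0 -mpolyC1.
  rewrite exprS; apply: (DM) => //; rewrite /D elim_varE; case: eqP => [->|_].
    by exists 1; rewrite opprK mulr1.
  by exists 0; rewrite subrr mulr0.
exists (l + l'); rewrite mulrDr -El -El' raddfD /= -mul_mpolyC.
by rewrite /=; ring.
Qed.

Lemma elim_var_fix A p q c : p \notin A -> ~~ hits (~: A) c ->
  'X_[c] \mPo elim_var p q = 'X_[c].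
Proof.
move=> pA /hitsPn c0; rewrite comp_mpolyX [RHS]mpolyXE_id; apply: eq_bigr => i _.
rewrite tnth_mktuple; case: eqP => // ->; rewrite c0 ?expr0 //.
by rewrite inE.
Qed.

(** The substitution fixes the [A]-part of each monomial, and this part already lies in [V]. *)
Lemma elim_var_mono A V p q h : primset A V -> p \notin A ->
  mono V h -> mono V (h \mPo elim_var p q).
Proof.
move=> pV pA; have iV := mono_ideal k (primset_up pV).
apply: (mono_sub (K := fun h => mono V (h \mPo elim_var p q))) => [|a Va].
  split=> [|g g' Hg Hg'|r g Hg].
  - by rewrite raddf0; apply: mono0.
  - by rewrite raddfD; apply: monoD.
  - by rewrite rmorphM; apply: (idMl _ iV).
pose c := [multinom (if i \in A then a i else 0)%N | i < n].
have -> : a = (c + (a - c))%MM.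
  by apply/mnmP=> i; rewrite mnmDE mnmBE mnmE; case: ifP => _; rewrite ?subnn ?addn0 ?subn0.
rewrite mpolyXD rmorphM /=; apply: (idMr _ iV).
rewrite (elim_var_fix _ pA) //; last first.
  by apply/hitsPn=> i; rewrite inE mnmE => /negPf->.
by apply/monoX; apply: pV.1 Va => i iA; rewrite mnmE iA.
Qed.

(* Modulo ['X_p + 'X_q] the ring is again a polynomial ring in which the
   variable [p] has been eliminated and [V] is unchanged. *)
Lemma nzdiv_adjoin_sum A V p q g : primset A V -> p \notin A ->  p != q ->
  ~ mono (hits A) (g \mPo elim_var p q) ->
  nzdiv (adjoin (mono V) ('X_p + 'X_q)) g.
Proof.
move=> pV pA pq ng h [l /(elim_var_mono (q := q) pV pA)].
rewrite raddfB /= !rmorphM raddfD /= !elim_varE eqxx eq_sym (negPf pq) addNr mul0r subr0.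
move/(nzdiv_mono pV ng) => Hh; have [l' El'] := elim_var_mod p q h.
by exists l'; rewrite -El' opprB addrC subrK.
Qed.

(** Glue [V1 ∩ V3] with [V2 ∩ V3], whose sum is [V3] by the inclusion hypothesis. Gluing [V1] and
    [V2] directly would not do: in the application the radical of their sum is the maximal ideal. *)
Lemma nzdiv2_glue (A1 A2 A3 : {set 'I_n}) (V1 V2 V3 : 'X_{1..n} -> Prop) f g :
  primset A1 V1 -> primset A2 V2 -> primset A3 V3 ->
  (forall a, V3 a -> V1 a \/ V2 a) ->
  ~ mono (hits (A1 :|: A3)) f -> ~ mono (hits (A2 :|: A3)) f -> ~ mono (hits A3) f ->
  nzdiv (adjoin (mono V1) f) g -> nzdiv (adjoin (mono V2) f) g ->
  nzdiv (adjoin (mono V3) f) g ->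
  nzdiv (adjoin (mono (fun a => [/\ V1 a, V2 a & V3 a])) f) g.
Proof.
move=> p1 p2 p3 V312 n13 n23 n3 r1 r2 r3 h Hh.
have up1 := primset_up p1; have up2 := primset_up p2; have up3 := primset_up p3.
have i1 := mono_ideal k up1; have i2 := mono_ideal k up2; have i3 := mono_ideal k up3.
have /r1 h1 : adjoin (mono V1) f (g * h).
  by apply: adjoin_sub Hh => e; apply: monoS => a [].
have /r2 h2 : adjoin (mono V2) f (g * h).
  by apply: adjoin_sub Hh => e; apply: monoS => a [].
have /r3 h3 : adjoin (mono V3) f (g * h).
  by apply: adjoin_sub Hh => e; apply: monoS => a [].
have glue A B V W : primset A V -> primset B W -> ~ mono (hits (A :|: B)) f ->
    adjoin (mono V) f h -> adjoin (mono W) f h ->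
    adjoin (fun r => mono V r /\ mono W r) f h.
  move=> pV pW nf; have upV := primset_up pV; have upW := primset_up pW.
  apply: (adjoin_glue (C := mono (fun a => V a \/ W a)));
    [exact: mono_ideal|exact: mono_ideal|by move=> r; apply: monoS => a; left|
     by move=> r; apply: monoS => a; right| | |exact: nzdiv_mono (primsetU pV pW) nf].
  - exact: mono_ideal (primset_up (primsetU pV pW)).
  - by move=> r; apply: monoU.
have h13 := glue _ _ _ _ p1 p3 n13 h1 h3.
have h23 := glue _ _ _ _ p2 p3 n23 h2 h3.
have idI V W : is_ideal (mono (k := k) V) -> is_ideal (mono (k := k) W) ->
    is_ideal (fun r : R => mono V r /\ mono W r).
  move=> iV iW; split=> [|a b [Va Wa] [Vb Wb]|r a [Va Wa]].
  - by split; apply: mono0.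
  - by split; apply: monoD.
  - by split; [apply: (idMl _ iV)|apply: (idMl _ iW)].
have h123 : adjoin (fun r => (mono V1 r /\ mono V3 r) /\ (mono V2 r /\ mono V3 r)) f h.
  apply: (adjoin_glue (C := mono V3)) h13 h23; [exact: idI|exact: idI|by move=> r []|
    by move=> r []|exact: i3| |exact: nzdiv_mono p3 n3].
  move=> r r3'.
  have [|||a [b [Va Vb ->]]] := @monoU n k (fun a => V1 a /\ V3 a) (fun a => V2 a /\ V3 a) r.
  - by move=> a b le_ab [Va Wa]; split; [apply: up1 Va|apply: up3 Wa].
  - by move=> a b le_ab [Va Wa]; split; [apply: up2 Va|apply: up3 Wa].
  - by apply: monoS r3' => a Va; case: (V312 a Va); [left|right].
  by exists a, b; split=> //; split; [apply: monoS Va|apply: monoS Va|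
    apply: monoS Vb|apply: monoS Vb] => c [].
apply: adjoin_sub h123 => r [[r1' r3'] [r2' _]] a Ha.
by split; [apply: r1'|apply: r2'|apply: r3'].
Qed.

End DepthAtLeastTwo.

(** * The three components *)

Definition vx : 'I_5 := @Ordinal 5 0 isT.
Definition vy : 'I_5 := @Ordinal 5 1 isT.
Definition vz : 'I_5 := @Ordinal 5 2 isT.
Definition vu : 'I_5 := @Ordinal 5 3 isT.
Definition vv : 'I_5 := @Ordinal 5 4 isT.

Definition mon5 x y z u v : 'X_{1..5} := [multinom nth 0 [:: x; y; z; u; v] i | i < 5].

Lemma ord5P (P : 'I_5 -> Prop) : P vx -> P vy -> P vz -> P vu -> P vv -> forall i, P i.
Proof.
move=> Px Py Pz Pu Pv [[|[|[|[|[|//]]]]] Hi].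
- by rewrite (_ : Ordinal Hi = vx) //; apply: val_inj.
- by rewrite (_ : Ordinal Hi = vy) //; apply: val_inj.
- by rewrite (_ : Ordinal Hi = vz) //; apply: val_inj.
- by rewrite (_ : Ordinal Hi = vu) //; apply: val_inj.
- by rewrite (_ : Ordinal Hi = vv) //; apply: val_inj.
Qed.

(** Quotients become plain variables, which leaves linear goals. *)
Ltac lia_opaque_div :=
  repeat match goal with
  | H : context [divn ?a ?b] |- _ =>
      let q := fresh "quo" in set (q := divn a b) in *; clearbody q
  | |- context [divn ?a ?b] =>
      let q := fresh "quo" in set (q := divn a b) in *; clearbody q
  end; lia.

Section Components.
Variables m g : nat.
Implicit Types (a b c : 'X_{1..5}) (t : nat).

(* [QA], [QB] and [QC] are the exponents of the monomials of
   [(y) + (x^m, z^m)^2]; *)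
Definition QA a : Prop := 2 <= a vx %/ m + a vz %/ m + 2 * a vy.

(* of [(u, v^5, z v^3, z^(1+2g) v, z^(1+3g))]; the last three generators lie on a
   line from which the point [z^(1+g) v^2] is missing. *)
Definition QB a : Prop :=
  [|| 0 < a vu, 5 <= a vv, (1 <= a vz) && (3 <= a vv),
      (1 + 2 * g <= a vz) && (1 <= a vv) | 1 + 3 * g <= a vz].

(* and of [(x^(30m), z^(30m), v^(30m), x^(2m-1) z v^3, x^(2m-1-g) z^(1+g) v^2)] *)
Definition QC a : Prop :=
  [|| 30 * m <= a vx, 30 * m <= a vz, 30 * m <= a vv,
      [&& 2 * m <= a vx + 1, 1 <= a vz & 3 <= a vv]
    | [&& 2 * m <= a vx + 1 + g, 1 + g <= a vz & 2 <= a vv]].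

Hypotheses (g_gt0 : 0 < g) (g_le : g <= m).

Let m_gt0 : 0 < m. Proof. exact: leq_trans g_gt0 g_le. Qed.

Lemma primset_QA : primset [set i in [:: vx; vy; vz]] QA.
Proof.
split.
  move=> a b le_ab Qa; apply: leq_trans Qa _.
  by rewrite !leq_add ?leq_div2r ?leq_mul2l ?le_ab ?inE.
exists (2 * m) => a i; rewrite !inE /QA => /or3P[]/eqP-> le_a.
- by rewrite -addnA (leq_trans _ (leq_addr _ _)) // leq_divRL.
- by rewrite (leq_trans _ (leq_addl _ _)) //; lia.
- by rewrite addnAC (leq_trans _ (leq_addl _ _)) // leq_divRL.
Qed.

Lemma primset_QB : primset [set i in [:: vz; vu; vv]] QB.
Proof.
split.
  move=> a b le_ab; rewrite /QB.
  have := le_ab vz; have := le_ab vu; have := le_ab vv; rewrite !inE /= => /(_ isT) + /(_ isT) + /(_ isT).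
  lia.
by exists (5 + 3 * g) => a i; rewrite !inE /QB => /or3P[]/eqP-> le_a; lia.
Qed.

Lemma primset_QC : primset [set i in [:: vx; vz; vv]] QC.
Proof.
split.
  move=> a b le_ab; rewrite /QC.
  have := le_ab vx; have := le_ab vz; have := le_ab vv; rewrite !inE /= => /(_ isT) + /(_ isT) + /(_ isT).
  lia.
by exists (30 * m) => a i; rewrite !inE /QC => /or3P[]/eqP-> ->; rewrite ?orbT.
Qed.

Lemma QA_proper : ~ QA 0%MM.
Proof. by rewrite /QA !mnm0E !div0n. Qed.

Lemma QB_proper : ~ QB 0%MM.
Proof. by rewrite /QB !mnm0E. Qed.

Lemma QC_proper : ~ QC 0%MM.
Proof. rewrite /QC !mnm0E; lia. Qed.

Lemma pow_mon_step (V : 'X_{1..5} -> Prop) t a c :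
  V c -> (forall i, c i <= a i) -> pow_mon V t (a - c)%MM -> pow_mon V t.+1 a.
Proof.
move=> Vc le_ca Va; exists (a - c)%MM, c; split=> //.
by apply/mnmP=> i; rewrite mnmDE mnmBE subnK.
Qed.

(** Quotients by [m] are superadditive. Conversely, one of [y], [x^(2m)], [z^(2m)], [x^m z^m] can be
    split off, lowering the weight by exactly 2. *)
Lemma pow_QA t a : pow_mon QA t a <-> 2 * t <= a vx %/ m + a vz %/ m + 2 * a vy.
Proof.
split.
  elim: t a => [//|t IH] _ [b [c [/IH Hb Qc ->]]]; rewrite !mnmDE.
  have H p q : p %/ m + q %/ m <= (p + q) %/ m.
    by rewrite leq_divRL // mulnDl leq_add // leq_divM.
  have := H (b vx) (c vx); have := H (b vz) (c vz); rewrite /QA in Qc; lia_opaque_div.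
elim: t a => [//|t IH] a Ha.
have div q e : q <= e %/ m -> q * m <= e /\ (e - q * m) %/ m = e %/ m - q.
  rewrite leq_divRL // => le_e; split=> //.
  by rewrite -{2}(subnKC le_e) divnMDl // addKn.
have [y0|y_gt0] := posnP (a vy); last first.
  apply: (@pow_mon_step _ _ _ (mon5 0 1 0 0 0)); first by rewrite /QA !mnmE /=; lia_opaque_div.
    by apply: ord5P; rewrite mnmE //=.
  by apply: IH; rewrite !mnmBE !mnmE /= !subn0; lia_opaque_div.
have [x2|x2] := leqP 2 (a vx %/ m).
  have [lex Ex] := div _ _ x2.
  apply: (@pow_mon_step _ _ _ (mon5 (2 * m) 0 0 0 0)); first by rewrite /QA !mnmE /= mulnK //; lia_opaque_div.
    by apply: ord5P; rewrite mnmE //=.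
  by apply: IH; rewrite !mnmBE !mnmE /= Ex !subn0; lia_opaque_div.
have [z2|z2] := leqP 2 (a vz %/ m).
  have [lez Ez] := div _ _ z2.
  apply: (@pow_mon_step _ _ _ (mon5 0 0 (2 * m) 0 0)); first by rewrite /QA !mnmE /= mulnK //; lia_opaque_div.
    by apply: ord5P; rewrite mnmE //=.
  by apply: IH; rewrite !mnmBE !mnmE /= Ez !subn0; lia_opaque_div.
have [|lex Ex] := div 1 (a vx); first by lia_opaque_div.
have [|lez Ez] := div 1 (a vz); first by lia_opaque_div.
apply: (@pow_mon_step _ _ _ (mon5 (1 * m) 0 (1 * m) 0 0)).
- by rewrite /QA !mnmE /= !mulnK.
- by apply: ord5P; rewrite mnmE //=.
- by apply: IH; rewrite !mnmBE !mnmE /= Ez Ex !subn0; lia_opaque_div.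
Qed.

(** [p], [q], [r], [s] count the factors [z v^3], [z^(1+2g) v], [z^(1+3g)], [v^5]. *)
Lemma pow_QB_nec t a : pow_mon QB t a -> exists p q r s,
  [/\ t <= p + q + r + s + a vu, p + q + r + 2 * (g * q) + 3 * (g * r) <= a vz &
      3 * p + q + 5 * s <= a vv].
Proof.
elim: t a => [|t IH] a; first by exists 0, 0, 0, 0; rewrite muln0.
case=> b [c [/IH [p [q [r [s [H1 H2 H3]]]]] Qc ->]]; rewrite !mnmDE.
case/or4P: Qc => [Hc|Hc|/andP[Hc Hc']|/orP[/andP[Hc Hc']|Hc]].
- by exists p, q, r, s; split; lia.
- by exists p, q, r, s.+1; split; lia.
- by exists p.+1, q, r, s; split; lia.
- by exists p, q.+1, r, s; split; lia.
- by exists p, q, r.+1, s; split; lia.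
Qed.

Lemma pow_QB_suff t a p q r s :
  t <= p + q + r + s -> p + q + r + 2 * (g * q) + 3 * (g * r) <= a vz ->
  3 * p + q + 5 * s <= a vv -> pow_mon QB t a.
Proof.
elim: t a p q r s => [//|t IH] a p q r s H1 H2 H3.
case: p H1 H2 H3 => [|p] H1 H2 H3; last first.
  apply: (@pow_mon_step _ _ _ (mon5 0 0 1 0 3)); first by rewrite /QB !mnmE.
    by apply: ord5P; rewrite mnmE //=; lia.
  by apply: (IH _ p q r s); rewrite ?mnmBE ?mnmE /=; lia.
case: q H1 H2 H3 => [|q] H1 H2 H3; last first.
  apply: (@pow_mon_step _ _ _ (mon5 0 0 (1 + 2 * g) 0 1)); first by rewrite /QB !mnmE /=; lia.
    by apply: ord5P; rewrite mnmE //=; lia.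
  by apply: (IH _ 0 q r s); rewrite ?mnmBE ?mnmE /=; lia.
case: r H1 H2 H3 => [|r] H1 H2 H3; last first.
  apply: (@pow_mon_step _ _ _ (mon5 0 0 (1 + 3 * g) 0 0)); first by rewrite /QB !mnmE /=; lia.
    by apply: ord5P; rewrite mnmE //=; lia.
  by apply: (IH _ 0 0 r s); rewrite ?mnmBE ?mnmE /=; lia.
apply: (@pow_mon_step _ _ _ (mon5 0 0 0 0 5)); first by rewrite /QB !mnmE.
  by apply: ord5P; rewrite mnmE //=; lia.
by apply: (IH _ 0 0 0 s.-1); rewrite ?mnmBE ?mnmE /=; lia.
Qed.

(** [p], [q] count [w], [w'], and [i], [j], [l] count [x^(30m)], [z^(30m)], [v^(30m)]; negative
    terms are moved across to avoid truncated subtraction. *)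
Lemma pow_QC_nec t a : pow_mon QC t a -> exists p q i j l,
  [/\ p + q + i + j + l = t,
      2 * (m * p) + 2 * (m * q) + 30 * (m * i) <= a vx + p + q + g * q,
      p + q + g * q + 30 * (m * j) <= a vz & 3 * p + 2 * q + 30 * (m * l) <= a vv].
Proof.
elim: t a => [|t IH] a; first by exists 0, 0, 0, 0, 0; rewrite !muln0.
case=> b [c [/IH [p [q [i [j [l [H1 H2 H3 H4]]]]]] Qc ->]]; rewrite !mnmDE.
case/or4P: Qc => [Hc|Hc|Hc|/orP[/and3P[Hc Hc' Hc'']|/and3P[Hc Hc' Hc'']]].
- by exists p, q, i.+1, j, l; split; lia.
- by exists p, q, i, j.+1, l; split; lia.
- by exists p, q, i, j, l.+1; split; lia.
- by exists p.+1, q, i, j, l; split; lia.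
- by exists p, q.+1, i, j, l; split; lia.
Qed.

Lemma pow_QC_sub t a : m %| t + g -> pow_mon QC t a -> pow_mon QA t a \/ pow_mon QB t a.
Proof.
move=> /dvdnP[e Ee] /pow_QC_nec [p [q [i [j [l [Et Hx Hz Hv]]]]]].
have gj : g * j <= m * j by rewrite leq_mul2r g_le orbT.
have ml : l <= m * l by rewrite leq_pmull.
have mj : j <= m * j by rewrite leq_pmull.
(* In [z] and [v], [w'^2 = (z v^3)(z^(1+2g) v)] and [w'^3 = (z v^3)^2 z^(1+3g)]; every [q] except 1
   is a sum of twos and threes. *)
have [q2 [q3 [r [Eq ler Hr]]]] : exists q2 q3 r,
    [/\ q = 2 * q2 + 3 * q3 + r, r <= 1 & r = 1 -> q = 1].
  case: (ltnP 1 q) => [lt1q|]; last by exists 0, 0, q; split; lia.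
  exists ((q - 3 * odd q)./2), (odd q), 0; split=> //.
  by have := odd_double_half q; case: (odd q) => /=; lia.
have [[i0 [j0 l0 q1]]|HB] : (i = 0 /\ [/\ j = 0, l = 0 & q = 1]) \/
    ~ (i = 0 /\ [/\ j = 0, l = 0 & q = 1]) by apply: classic.
  (* Here [z] has exponent at least [t + g = e * m] and [x] at least
     [2 * m * t - (t + g) = (2 * t - e) * m], so rounding loses nothing. *)
  left; apply/pow_QA; subst i j l q; rewrite !muln0 in Hx Hz Hv.
  have Hz' : e <= a vz %/ m by rewrite leq_divRL //; lia.
  have Hx' : 2 * t - e <= a vx %/ m.
    rewrite leq_divRL // mulnBl -Ee; have -> : 2 * t * m = 2 * (m * t) by ring.
    have -> : t = p + 1 by lia.
    by lia.
  lia.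
have [Hij|Hij] := leqP (i + j + l) (2 * (j + l)).
  (* [z^(30m)] yields six factors [z^(1+3g)], as [g <= m], and [v^(30m)] six factors [v^5]; this
     surplus pays for [i] and [r]. *)
  right; apply: (@pow_QB_suff t a (p + q2 + 2 * q3) q2 (q3 + 6 * j) (6 * l)).
  - have : 0 < r -> 0 < j + l.
      move=> r_gt0; rewrite lt0n; apply/eqP=> jl0; apply: HB.
      have q1 : q = 1 by apply: Hr; lia.
      by split; [lia|split=> //; lia].
    lia.
  - by rewrite Eq in Hz; lia.
  - by rewrite Eq in Hv; lia.
(* The two exponents add up to at least [(2 * (p + q) + 30 * (i + j)) * m]. Rounding costs less than
   [2 * m], which [i > j + l] makes affordable. *)
left; apply/pow_QA; rewrite leqNgt; apply/negP=> Hlt.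
have := ltn_ceil (a vx) m_gt0; have := ltn_ceil (a vz) m_gt0.
move: Hlt; set ax := a vx %/ m; set az := a vz %/ m; clearbody ax az => Hlt Hz' Hx'.
have : (ax + az + 2) * m <= (2 * (p + q) + 30 * (i + j)) * m by rewrite leq_mul2r; apply/orP; right; lia.
lia.
Qed.

Definition test_mon t := (mon5 (2 * m - 1) 0 1 0 3 *+ t.-1 + mon5 (2 * m - 1 - g) 0 (1 + g) 0 2)%MM.

Lemma test_QC t : 0 < t -> pow_mon QC t (test_mon t).
Proof.
case: t => // t _; exists (mon5 (2 * m - 1) 0 1 0 3 *+ t)%MM, (mon5 (2 * m - 1 - g) 0 (1 + g) 0 2).
split=> //; last by rewrite /QC !mnmE /=; lia.
elim: t => [//|t IH]; exists (mon5 (2 * m - 1) 0 1 0 3 *+ t)%MM, (mon5 (2 * m - 1) 0 1 0 3).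
by split=> //; [rewrite /QC !mnmE /=; lia|rewrite mulmS addmC].
Qed.

(** Give [z] weight 1 and [v] weight [g]. The test monomial has weight [(1 + 3 * g) * t], each edge
    generator [1 + 3 * g], and [v^5] more, so [s = 0]. The [z]-exponent [t + g] then forces
    [q = r = 0], and [(z v^3)^t] needs one more [v]. *)
Lemma test_QB t : 0 < t -> ~ pow_mon QB t (test_mon t).
Proof.
case: t => // t _ /pow_QB_nec [p [q [r [s []]]]].
rewrite !mnmDE !mulmnE !mnmE /= => H1 H2 H3.
have s0 : s = 0.
  have : g * (t.+1 - s) <= g * (p + q + r) by rewrite leq_mul2l; apply/orP; right; lia.
  nia.
have q0 : q = 0 by nia.
have r0 : r = 0 by nia.
by subst; lia.
Qed.

(** The exponents of [x] and [z] sum to exactly [2 * m * t], so a nonzero remainder of [t + g]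
    modulo [m] makes the quotients sum to less than [2 * t]. *)
Lemma test_QA t : 0 < t -> ~~ (m %| t + g) -> ~ pow_mon QA t (test_mon t).
Proof.
case: t => // t _ ndv /pow_QA.
rewrite !mnmDE !mulmnE !mnmE /= => H.
have Hx := leq_divM ((2 * m - 1) * t + (2 * m - 1 - g)) m.
have Hz := divn_eq (1 * t + (1 + g)) m.
have Hr : 0 < (1 * t + (1 + g)) %% m.
  by rewrite lt0n mul1n addnA addn1; exact: ndv.
have Hx2 : (2 * m - 1) * t + (2 * m - 1 - g) + (t + 1 + g) = 2 * t.+1 * m by nia.
have : 2 * t.+1 * m <= (((2 * m - 1) * t + (2 * m - 1 - g)) %/ m + (1 * t + (1 + g)) %/ m) * m.
  by rewrite leq_mul2r; apply/orP; right; lia.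
lia.
Qed.

End Components.

(** * Depth for the three components *)

Section Assembly.
Local Open Scope ring_scope.
Variable k : fieldType.
Notation R := {mpoly k[5]}.

Definition supp3 (j : 'I_3) : {set 'I_5} :=
  [set i in nth [::] [:: [:: vx; vy; vz]; [:: vz; vu; vv]; [:: vx; vz; vv]] j].

Definition fam3 (V1 V2 V3 : 'X_{1..5} -> Prop) (j : 'I_3) : 'X_{1..5} -> Prop :=
  match val j with 0 => V1 | 1 => V2 | _ => V3 end.

Lemma fam3P V1 V2 V3 a : meet (fam3 V1 V2 V3) a <-> [/\ V1 a, V2 a & V3 a].
Proof.
split; last by case=> ? ? ? [[|[|[|//]]]].
move=> H; split; [exact: (H (@Ordinal 3 0 isT))|exact: (H (@Ordinal 3 1 isT))|
  exact: (H (@Ordinal 3 2 isT))].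
Qed.

Lemma supp3_incomp i j : supp3 i \subset supp3 j -> i = j.
Proof.
move=> /subsetP H; apply: val_inj; move: H.
case: i j => [[|[|[|//]]] Hi] [[|[|[|//]]] Hj] //= H.
- by have := H vx; rewrite !inE => /(_ isT).
- by have := H vy; rewrite !inE => /(_ isT).
- by have := H vv; rewrite !inE => /(_ isT).
- by have := H vu; rewrite !inE => /(_ isT).
- by have := H vv; rewrite !inE => /(_ isT).
- by have := H vx; rewrite !inE => /(_ isT).
Qed.

Lemma max_idealE (f : R) : max_ideal f <-> mono (hits setT) f.
Proof.
split.
  move/(_ _ (hits_ideal k setT)); apply=> _ [i ->]; apply/monoX/exists_inP.
  by exists i; rewrite ?inE // mnm1E eqxx.
apply: mono_hits_sub; first exact: gen_ideal_ideal.
by move=> i _; apply: gen_idealS; exists i.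
Qed.

Lemma max_ideal_ideal : is_ideal (max_ideal (k := k)).
Proof. exact: gen_ideal_ideal. Qed.

Lemma max_ideal1 : ~ max_ideal (1 : R).
Proof. by move/max_idealE; have [_ + _] := hits_prime k [set: 'I_5]. Qed.

Lemma max_idealX i : max_ideal ('X_i : R).
Proof. by apply: gen_idealS; exists i. Qed.

Lemma nhits_coef (A : {set 'I_5}) i (f : R) : i \notin A -> f@_(U_(i)) != 0 ->
  ~ mono (hits A) f.
Proof.
move=> iA fi /(_ U_(i)%MM); rewrite mcoeff_msupp => /(_ fi)/exists_inP[l lA].
by rewrite mnm1E; case: eqP lA iA => // <- ->.
Qed.

Section ThreeComponents.
Variables V1 V2 V3 : 'X_{1..5} -> Prop.
Hypothesis prim : forall j, primset (supp3 j) (fam3 V1 V2 V3 j).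
Hypothesis proper : forall j, ~ fam3 V1 V2 V3 j 0%MM.
Notation W := (fam3 V1 V2 V3).
Notation J := (mono (k := k) (meet W)).
(** [f] has a variable outside each radical, and outside the union of the third with either other
    one. After eliminating [u] or [y] by [f], [g] keeps [v], [x], [y] outside the first, second,
    third radical. *)
Let f : R := 'X_vu + 'X_vy.
Let g : R := 'X_vx + 'X_vy + 'X_vv.

Let o1 : 'I_3 := @Ordinal 3 0 isT.
Let o2 : 'I_3 := @Ordinal 3 1 isT.
Let o3 : 'I_3 := @Ordinal 3 2 isT.

Let iJ : is_ideal J. Proof. exact/mono_ideal/(upset_meet prim). Qed.

Let JM h : J h -> max_ideal h.
Proof.
move/(meet_hits prim proper o1) => Hh; apply/max_idealE; apply: monoS Hh => a.
by move/exists_inP=> [i _ ai]; apply/exists_inP; exists i.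
Qed.

Let max_f : max_ideal f.
Proof. by apply: (idD max_ideal_ideal); apply: max_idealX. Qed.

Let max_g : max_ideal g.
Proof. by do 2 ?apply: (idD max_ideal_ideal); apply: max_idealX. Qed.

Let nzdiv_f : nzdiv J f.
Proof.
have H j : nzdiv (mono (W j)) f.
  apply: (nzdiv_mono (prim j)); case: j => [[|[|[|//]]] Hj].
  - by apply: (@nhits_coef _ vu); rewrite ?inE // mcoeffD !mcoeffXU addr0 oner_eq0.
  - by apply: (@nhits_coef _ vy); rewrite ?inE // mcoeffD !mcoeffXU add0r oner_eq0.
  - by apply: (@nhits_coef _ vy); rewrite ?inE // mcoeffD !mcoeffXU add0r oner_eq0.
by move=> h Hh a Ha j; apply: H Ha; apply: monoS Hh => b; apply.
Qed.

Lemma depth_ge1 : regular_seq (max_ideal (k := k)) J [:: f].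
Proof. exact: regular_seq_1 max_ideal_ideal iJ JM max_ideal1 max_f nzdiv_f. Qed.

Lemma depth_eq1 a : ~ V1 a -> ~ V2 a -> V3 a -> depth_quot J 1.
Proof.
move=> n1 n2 Va; split; first by exists [:: f]; split=> //; apply: depth_ge1.
move=> [|f1 [|f2 fs]] // rs; exfalso.
have [/max_idealE M1 r1] := regular_seq1 iJ rs.
have [/max_idealE M2 r2] := regular_seq2 iJ rs.
apply: (not_regular2 (i1 := o1) (i2 := o2) (a := a) prim supp3_incomp _ _ _ _ M1 M2 r1 r2) => //.
  by apply/setP; apply: ord5P; rewrite !inE.
by case=> [[|[|[|//]]] Hj].
Qed.

Lemma depth_eq2 : (forall a, V3 a -> V1 a \/ V2 a) -> depth_quot J 2.
Proof.
move=> V312; split; last first.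
  move=> [|f1 [|f2 [|f3 fs]]] // rs; exfalso.
  have [/max_idealE M1 r1] := regular_seq1 iJ rs.
  have [/max_idealE M2 r2] := regular_seq2 iJ rs.
  have [/max_idealE M3 r3] := regular_seq3 iJ rs.
  (* The two variables outside [supp3 j]. *)
  pose p (j : 'I_3) := nth vu [:: vu; vx; vy] j.
  pose q (j : 'I_3) := nth vu [:: vv; vy; vu] j.
  apply: (not_regular3 (p := p) (q := q) prim _ (hits_prime k setT) _ M1 M2 M3 r1 r2 r3).
    by case=> [[|[|[|//]]] Hj]; apply: ord5P; rewrite !inE.
  by move=> h /JM/max_idealE.
exists [:: f; g]; split=> //.
apply: (regular_seq_2 max_ideal_ideal iJ JM max_ideal1 max_f max_g nzdiv_f).
have r1 : nzdiv (adjoin (mono V1) f) g.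
  apply: (nzdiv_adjoin_sum (prim o1)); rewrite ?inE //.
  apply: (@nhits_coef _ vv); rewrite ?inE //.
  by rewrite /g !raddfD /= !elim_varE /= !mcoeffXU /= !add0r oner_eq0.
have r2 : nzdiv (adjoin (mono V2) f) g.
  (* The second radical contains [u], so [y] is eliminated instead. *)
  rewrite /f addrC; apply: (nzdiv_adjoin_sum (prim o2)); rewrite ?inE //.
  apply: (@nhits_coef _ vx); rewrite ?inE //.
  by rewrite /g !raddfD /= !elim_varE /= !mcoeffN !mcoeffXU /= oppr0 !addr0 oner_eq0.
have r3 : nzdiv (adjoin (mono V3) f) g.
  apply: (nzdiv_adjoin_sum (prim o3)); rewrite ?inE //.
  apply: (@nhits_coef _ vy); rewrite ?inE //.
  by rewrite /g !raddfD /= !elim_varE /= !mcoeffXU /= add0r addr0 oner_eq0.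
have : nzdiv (adjoin (mono (fun a => [/\ V1 a, V2 a & V3 a])) f) g.
  apply: (nzdiv2_glue (prim o1) (prim o2) (prim o3) V312 _ _ _ r1 r2 r3).
  - by apply: (@nhits_coef _ vu); rewrite ?inE // mcoeffD !mcoeffXU addr0 oner_eq0.
  - by apply: (@nhits_coef _ vy); rewrite ?inE // mcoeffD !mcoeffXU add0r oner_eq0.
  - by apply: (@nhits_coef _ vy); rewrite ?inE // mcoeffD !mcoeffXU add0r oner_eq0.
move=> rg h Hh; have /rg : adjoin (mono (fun a => [/\ V1 a, V2 a & V3 a])) f (g * h).
  by apply: adjoin_sub Hh => e; apply: monoS => a /fam3P.
by apply: adjoin_sub => e; apply: monoS => a /fam3P.
Qed.

End ThreeComponents.
End Assembly.

Theorem theorem4p4 (k : fieldType) (m d : nat) :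
  (2 <= m)%N -> (d < m)%N ->
  exists I : ideal_t {mpoly k[5]},
    monomial_ideal I /\
    forall t : nat, (1 <= t)%N ->
      depth_quot (symb_pow I t) (if t == d %[mod m] then 2 else 1).
Proof.
move=> m_ge2 lt_dm; pose g := m - d.
have g_gt0 : 0 < g by rewrite subn_gt0.
have g_le : g <= m by apply: leq_subr.
pose Q := fam3 (QA m) (QB g) (QC m g).
have primQ j : primset (supp3 j) (Q j).
  case: j => [[|[|[|//]]] Hj];
  [exact: primset_QA g_gt0 g_le|exact: primset_QB|exact: primset_QC].
have properQ j : ~ Q j 0%MM.
  case: j => [[|[|[|//]]] Hj]; [exact: QA_proper|exact: QB_proper|exact: QC_proper g_gt0 g_le].
exists (mono (meet Q)); split.
  by exists (meet Q) => f; apply: meet_monomial primQ f.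
move=> t t_gt0.
pose W := fam3 (pow_mon (QA m) t) (pow_mon (QB g) t) (pow_mon (QC m g) t).
have QW j : pow_mon (Q j) t = W j by case: j => [[|[|[|]]]].
have primW j : primset (supp3 j) (W j) by rewrite -QW; apply: primset_pow.
have properW j : ~ W j 0%MM.
  (* Positivity of [t] matters: the power 0 contains the exponent 0. *)
  rewrite -QW; case: t t_gt0 {W QW primW} => // t _ [b [c [_ Qc E]]].
  apply: (properQ j); suff -> : 0%MM = c by [].
  by apply/eqP; move/eqP: E; rewrite eq_sym mnmD_eq0 => /andP[_]; rewrite eq_sym.
apply: (has_depth_ext (J := mono (meet W))).
  move=> f; rewrite (symb_pow_meet primQ supp3_incomp properQ).
  by split; apply: monoS => a H j; [rewrite QW|rewrite -QW]; apply: H.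
(* Since [d + g = m], adding [g] turns the congruence into divisibility. *)
have -> : (t == d %[mod m]) = (m %| t + g).
  by rewrite -(eqn_modDr g) /g subnKC ?(ltnW lt_dm) // modnn.
case: ifP => [dv|/negbT ndv].
  by apply: depth_eq2 => // a; apply: pow_QC_sub.
by apply: (@depth_eq1 k _ _ _ primW properW (test_mon m g t)); [apply: test_QA|apply: test_QB|apply: test_QC].
Qed.
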